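(* Let $X$ be an octahedral real Banach space and let $\kappa$ be any infinite cardinal. Then there exist an infinite set $J$ and a countably incomplete ultrafilter $\mathcal U$ over $J$ such that the ultrapower $X_{\mathcal U}$ is $\kappa$-rigid octahedral.
   Context: $S_E$ is the unit sphere of $E$. For an infinite cardinal $\kappa$, a Banach space $E$ is $\kappa$-octahedral if for every cardinal $\kappa'<\kappa$, every collection $\{x_\alpha:\alpha<\kappa'\}\subseteq S_E$ and every $\varepsilon>0$ there exists $x\in S_E$ such that $\Vert x_\alpha+x\Vert\geq 2-\varepsilon$ for all $\alpha<\kappa'$. It is $\kappa$-rigid octahedral if for every such collection there is $x\in S_E$ with $\Vert x_\alpha+x\Vert=2$ for all $\alpha<\kappa'$. ''Octahedral'' without a cardinal means $\omega_0$-octahedral. An ultrafilter $\mathcal U$ over $J$ is countably incomplete if there is a sequence $(A_n)$ in $\mathcal U$ with $\bigcap_n A_n=\emptyset$ (such an ultrafilter is free). The ultrapower is $X_{\mathcal U}:=\ell_\infty(J,X)/N_{\mathcal U}$, where $\ell_\infty(J,X)$ is the space of bounded functions $f:J\to X$ with the supremum norm and $N_{\mathcal U}=\{f:\lim_{\mathcal U}\Vert f(j)\Vert=0\}$; its quotient norm is $\Vert [x_j]_{\mathcal U}\Vert=\lim_{\mathcal U}\Vert x_j\Vert$. *)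

(* Defs.v *)
From HB Require Import structures.
From mathcomp Require Import all_boot all_order all_algebra.
From mathcomp Require Import generic_quotient ring_quotient.
From mathcomp Require Import all_classical all_reals.
From mathcomp Require Import topology normedtype sequences.
From mathcomp Require Import lra.

Set Implicit Arguments.
Unset Strict Implicit.
Unset Printing Implicit Defensive.

Import Order.TTheory GRing.Theory Num.Theory.
Import numFieldNormedType.Exports.

Local Open Scope classical_set_scope.
Local Open Scope ring_scope.
Local Open Scope quotient_scope.
Local Open Scope card_scope.

Definition card_lt (T U : Type) (A : set T) (B : set U) : Prop :=
  A #<= B /\ A #!= B.

(* The infinite cardinal kappa is represented by a type K of that cardinality,
   and the cardinals kappa' < kappa by the types I with card_lt I K. *)
Definition card_octahedral (R : realType) (K : Type)
    (E : completeNormedModType R) : Prop :=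
  forall I : Type, card_lt [set: I] [set: K] ->
  forall x : I -> E, (forall a, `|x a| = 1) ->
  forall eps : R, 0 < eps ->
  exists2 y : E, `|y| = 1 & forall a, 2 - eps <= `|x a + y|.

Definition card_rigid_octahedral (R : realType) (K : Type)
    (E : completeNormedModType R) : Prop :=
  forall I : Type, card_lt [set: I] [set: K] ->
  forall x : I -> E, (forall a, `|x a| = 1) ->
  exists2 y : E, `|y| = 1 & forall a, `|x a + y| = 2.

(* nat has cardinality omega_0. *)
Definition octahedral (R : realType) (E : completeNormedModType R) : Prop :=
  card_octahedral nat E.

Definition countably_incomplete (J : Type) (U : set_system J) : Prop :=
  exists A : nat -> set J, (forall n, U (A n)) /\ \bigcap_n A n = set0.

(* The bounded functions J -> X. Their supremum norm is only used in
   [ultra_norm_quotient], so [linf] carries no normed structure. *)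
Section linf.
Context (R : realType) (J : Type) (X : normedModType R).

Definition linf_pred : {pred (J -> X)} :=
  [pred f | `[< [bounded f j | j in setT] >]].

Record linf := Linf { linf_val :> J -> X ; linf_valP : linf_val \in linf_pred }.

HB.instance Definition _ := [isSub for linf_val].
HB.instance Definition _ := [Choice of linf by <:].

Lemma linf_predP (f : J -> X) :
  f \in linf_pred <-> exists M, forall j, `|f j| <= M.
Proof.
split=> [/asboolP/pinfty_ex_gt0[M _ hM]|[M hM]].
  by exists M => j; exact: hM.
apply/asboolP; exists M; split; first exact: num_real.
by move=> N /ltW MN j _; exact: le_trans (hM j) MN.
Qed.

Lemma linf_submod_closed : submod_closed linf_pred.
Proof.
split; first by apply/linf_predP; exists 0 => j; rewrite normr0.
move=> a f g /linf_predP[M hM] /linf_predP[N hN].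
apply/linf_predP; exists (`|a| * M + N) => j.
rewrite (le_trans (ler_normD _ _))// lerD//.
by rewrite normrZ ler_wpM2l.
Qed.

HB.instance Definition _ :=
  GRing.isSubmodClosed.Build R (J -> X) linf_pred linf_submod_closed.
HB.instance Definition _ := [SubChoice_isSubLmodule of linf by <:].

End linf.

Section ultrapower.
Context (R : realType) (J : Type) (X : completeNormedModType R).
Context (U : set_system J) (UU : UltraFilter U).
Implicit Types f g : linf J X.

Lemma linf_bound f : exists M, forall j, `|f j| <= M.
Proof. exact/linf_predP/linf_valP. Qed.

Lemma linf_eqP f g : f =1 g -> f = g.
Proof. by move=> fg; apply/val_inj/funext. Qed.

Definition ulim f : R := lim (`|f j| @[j --> U]).

(* N_U. The limit defining [ulim] always exists, see [ulim_cvg]. *)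
Definition null_pred : {pred linf J X} :=
  [pred f : linf J X | `[< `|f j| @[j --> U] --> (0 : R) >]].

Lemma ulim_cvg f : `|f j| @[j --> U] --> ulim f.
Proof.
have [M hM] := linf_bound f.
pose G : set_system R := (fun j => `|f j|) @ U.
have GU : UltraFilter G.
  split; first exact: fmap_proper_filter.
  move=> H HH GH; apply/seteqP; split=> [A HA|]; last exact: GH.
  have [//|UnA] := in_ultra_setVsetC ((fun j => `|f j|) @^-1` A) UU.
  have /GH HnA : G (~` A) by [].
  have /filter_ex[z []//] : H (A `&` ~` A) by exact: filterI.
have GM : G `[0, M]%classic.
  rewrite /G nbhs_simpl/=; apply: filterE => j /=.
  by rewrite in_itv/= normr_ge0 hM.
have := @segment_compact R 0 M.
rewrite compact_ultra => /(_ G GU GM)[p [_ Gp]].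
by apply/cvg_ex; exists p.
Qed.

Lemma ulimP f (l : R) : `|f j| @[j --> U] --> l -> ulim f = l.
Proof. exact: cvg_lim. Qed.

Lemma null_predE f : (f \in null_pred) = (ulim f == 0).
Proof.
apply/asboolP/eqP; first exact: ulimP.
by move=> <-; exact: ulim_cvg.
Qed.

Lemma ler_Ulim (u v : J -> R) (a b : R) :
  u @ U --> a -> v @ U --> b -> (forall j, u j <= v j) -> a <= b.
Proof.
move=> ua vb uv; rewrite -subr_ge0; apply: (cvgr_to_ge (cvgB vb ua)).
by apply: nearW => j; rewrite subr_ge0; exact: uv.
Qed.

Lemma ulimD f g : ulim (f + g) <= ulim f + ulim g.
Proof.
apply: (ler_Ulim (@ulim_cvg (f + g)) (cvgD (@ulim_cvg f) (@ulim_cvg g))) => j.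
exact: ler_normD.
Qed.

Lemma ulimZ (a : R) f : ulim (a *: f) = `|a| * ulim f.
Proof.
apply: ulimP; have -> : (fun j => `|(a *: f) j|) = (fun j => `|a| * `|f j|).
  by apply/funext => j; exact: normrZ.
apply: cvgM; [exact: cvg_cst|exact: ulim_cvg].
Qed.

Lemma ulim_ge0 f : 0 <= ulim f.
Proof.
by apply: (ler_Ulim (cvg_cst 0) (@ulim_cvg f)) => j; exact: normr_ge0.
Qed.

Lemma ulim_le f M : (forall j, `|f j| <= M) -> ulim f <= M.
Proof.
by move=> hM; exact: (ler_Ulim (@ulim_cvg f) (cvg_cst M)).
Qed.

Lemma null_submod_closed : submod_closed null_pred.
Proof.
have ulim0 : ulim 0 = 0 by rewrite -(scale0r 0) ulimZ normr0 mul0r.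
split; first by rewrite null_predE ulim0.
move=> a f g; rewrite !null_predE => /eqP f0 /eqP g0.
rewrite eq_le ulim_ge0 andbT (le_trans (ulimD _ _))//.
by rewrite ulimZ f0 g0 mulr0 addr0.
Qed.

HB.instance Definition _ :=
  GRing.isSubmodClosed.Build R (linf J X) null_pred null_submod_closed.

(* The ultrapower depends on the proof UU only because its norm, the limit
   along U, makes it a normed space when U is an ultrafilter. The library's
   [UltraFilter U] says that U is a maximal proper filter. *)
Definition ultrapower : Type := Quotient.quot null_pred.

HB.instance Definition _ := GRing.Zmodule.on ultrapower.
HB.instance Definition _ := Quotient.on ultrapower.

Definition ultraclass f : ultrapower := \pi_ultrapower f.

Lemma ultraclassK (q : ultrapower) : ultraclass (repr q) = q.
Proof. exact: reprK. Qed.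

Lemma ultraclassD f g : ultraclass (f + g) = ultraclass f + ultraclass g.
Proof. exact: Quotient.pi_add. Qed.

Lemma ultraclassN f : ultraclass (- f) = - ultraclass f.
Proof. exact: Quotient.pi_opp. Qed.

Lemma ultraclass0 : ultraclass 0 = 0.
Proof. by rewrite -(subrr (0 : linf J X)) ultraclassD ultraclassN subrr. Qed.

Lemma ultraclass_eq f g : ultraclass f = ultraclass g <-> ulim (f - g) = 0.
Proof.
rewrite (rwP eqP) (rwP (ulim (f - g) =P 0)) -null_predE.
by rewrite Quotient.idealrBE.
Qed.

Definition ultra_scale (a : R) (q : ultrapower) : ultrapower :=
  ultraclass (a *: repr q).

Lemma ultraclassZ a f : ultraclass (a *: f) = ultra_scale a (ultraclass f).
Proof.
apply/ultraclass_eq; rewrite -scalerBr ulimZ.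
have /ultraclass_eq -> : ultraclass f = ultraclass (repr (ultraclass f)).
  by rewrite ultraclassK.
by rewrite mulr0.
Qed.

Fact ultra_scalerA a b q :
  ultra_scale a (ultra_scale b q) = ultra_scale (a * b) q.
Proof. by rewrite -(ultraclassK q) -!ultraclassZ scalerA. Qed.

Fact ultra_scale1r : left_id 1 ultra_scale.
Proof. by move=> q; rewrite -(ultraclassK q) -ultraclassZ scale1r. Qed.

Fact ultra_scalerDr : right_distributive ultra_scale +%R.
Proof.
move=> a p q; rewrite -(ultraclassK p) -(ultraclassK q).
by rewrite -ultraclassD -!ultraclassZ scalerDr ultraclassD.
Qed.

Fact ultra_scalerDl q : {morph ultra_scale^~ q : a b / a + b}.
Proof.
by move=> a b; rewrite -(ultraclassK q) -!ultraclassZ scalerDl ultraclassD.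
Qed.

HB.instance Definition _ := GRing.Zmodule_isLmodule.Build R ultrapower
  ultra_scalerA ultra_scale1r ultra_scalerDr ultra_scalerDl.

Definition ultra_norm (q : ultrapower) : R := ulim (repr q).

Lemma ulim_eq f g : ultraclass f = ultraclass g -> ulim f = ulim g.
Proof.
have le h k : ultraclass h = ultraclass k -> ulim h <= ulim k.
  move=> /ultraclass_eq hk0; rewrite -[h](subrK k).
  by rewrite (le_trans (ulimD _ _))// hk0 add0r.
by move=> fg; apply/eqP; rewrite eq_le !le.
Qed.

Lemma ultra_normE f : ultra_norm (ultraclass f) = ulim f.
Proof. by apply: ulim_eq; rewrite ultraclassK. Qed.

Fact ultra_normD p q : ultra_norm (p + q) <= ultra_norm p + ultra_norm q.
Proof.
rewrite -(ultraclassK p) -(ultraclassK q) -ultraclassD !ultra_normE.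
exact: ulimD.
Qed.

Fact ultra_normZ (a : R) (q : ultrapower) :
  ultra_norm (a *: q) = `|a| * ultra_norm q.
Proof. by rewrite ultra_normE ulimZ. Qed.

Fact ultra_norm_eq0 q : ultra_norm q = 0 -> q = 0.
Proof.
rewrite -(ultraclassK q) ultra_normE -ultraclass0 => q0.
by apply/ultraclass_eq; rewrite subr0.
Qed.

HB.instance Definition _ := Lmodule_isNormed.Build R ultrapower
  ultra_normD ultra_normZ ultra_norm_eq0.

Lemma norm_ultraclass f : `|ultraclass f| = lim (`|f j| @[j --> U]).
Proof. exact: ultra_normE. Qed.

Lemma ultraclass_lift (q : ultrapower) (e : R) : `|q| < e ->
  exists2 f, ultraclass f = q & forall j, `|f j| <= e.
Proof.
move=> qe; have e0 : 0 <= e by rewrite (le_trans _ (ltW qe)).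
pose h j := if `|repr q j| <= e then repr q j else 0.
have he j : `|h j| <= e by rewrite /h; case: ifPn => // _; rewrite normr0.
have hP : h \in @linf_pred R J X by apply/linf_predP; exists e.
exists (Linf hP) => //; rewrite -[RHS]ultraclassK; apply/ultraclass_eq.
apply: ulimP; apply: cvg_near_cst.
have : \forall j \near U, `|repr q j| < e.
  by apply: (cvgr_lt _ (ulim_cvg (f := repr q))); exact: qe.
apply: filterS => j /ltW qje; apply/normr0P/eqP.
rewrite -[LHS]/(h j - repr q j) /h qje; exact: subrr.
Qed.

(* The norm is the quotient norm of the supremum norm of [linf]. *)
Lemma ultra_norm_quotient (q : ultrapower) :
  `|q| = inf [set sup (range (fun j => `|f j|)) |
              f in [set f : linf J X | ultraclass f = q]].
Proof.
set S := (X in inf X).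
have /filter_ex[j0 _] : U setT by exact: filterT.
have rng0 f : range (fun j => `|f j|) !=set0 by exists `|f j0|, j0.
have le_q : lbound S `|q|.
  move=> _ [f fq <-]; rewrite -fq norm_ultraclass.
  apply: ulim_le => j; apply: ub_le_sup; last by exists j.
  by have [M hM] := linf_bound f; exists M => _ [i _ <-].
have S0 : S !=set0.
  by exists (sup (range (fun j => `|repr q j|))), (repr q) => //; exact: reprK.
apply/eqP; rewrite eq_le lb_le_inf//=; apply/ler_addgt0Pr => e e0.
have [f fq fe] : exists2 f, ultraclass f = q & forall j, `|f j| <= `|q| + e.
  by apply: ultraclass_lift; rewrite ltrDl.
apply: (@le_trans _ _ (sup (range (fun j => `|f j|)))).
  by apply: ge_inf; [by exists (`|q|)|by exists f].
by apply: ge_sup => // _ [j _ <-].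
Qed.

Fact ultrapower_complete (F : set_system ultrapower) :
  ProperFilter F -> cauchy F -> cvg F.
Proof.
move=> FF /cauchyP Fc.
pose r n : R := 2^-1 ^+ n.
have r0 n : 0 < r n by rewrite exprn_gt0 ?invr_gt0.
have rS n : r n.+1 + r n.+1 = r n by rewrite /r exprSr -splitr.
have r_cvg : r @ \oo --> (0 : R).
  by apply: cvg_expr; rewrite ger0_norm ?invr_ge0 ?invf_lt1 ?ltr0n ?ltr1n.
have {Fc} /choice[q qF] n : exists x : ultrapower, F (ball x (r n)).
  exact: Fc.
have qS n : `|q n.+1 - q n| < 2 * r n.
  have /filter_ex[z [zn zSn]] : F (ball (q n) (r n) `&` ball (q n.+1) (r n.+1)).
    exact: filterI.
  move: zn zSn; rewrite -!ball_normE /= => zn zSn.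
  have rle : r n.+1 <= r n by rewrite -(rS n) lerDl ltW.
  rewrite -(subrKA z) mulr_natl mulr2n.
  rewrite (le_lt_trans (ler_normD _ _))// ltrD//; last by rewrite distrC.
  exact: lt_le_trans zSn rle.
have {qS} /choice[g gP] n : exists h : linf J X,
    ultraclass h = q n.+1 - q n /\ forall j, `|h j| <= 2 * r n.
  by have [h] := ultraclass_lift (qS n); exists h.
pose s n : linf J X := repr (q 0) + \sum_(k < n) g k.
have sS n : s n.+1 = s n + g n by rewrite /s big_ord_recr addrA.
have sq n : ultraclass (s n) = q n.
  elim: n => [|n IHn]; first by rewrite /s big_ord0 addr0 ultraclassK.
  by rewrite sS ultraclassD IHn (gP n).1 addrC subrK.
have s_dist j n k : `|s (n + k)%N j - s n j| <= 4 * r n - 4 * r (n + k)%N.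
  elim: k => [|k IHk]; first by rewrite addn0 !subrr normr0.
  rewrite addnS sS.
  have -> : (s (n + k)%N + g (n + k)%N) j - s n j =
      (s (n + k)%N j - s n j) + g (n + k)%N j.
    by rewrite addrAC.
  rewrite (le_trans (ler_normD _ _))// (le_trans (lerD IHk ((gP _).2 j)))//.
  by rewrite -(rS (n + k)%N); lra.
have s_dist4 j n k : `|s (n + k)%N j - s n j| <= 4 * r n.
  rewrite (le_trans (s_dist j n k))// gerBl mulr_ge0// ltW//.
have r4_cvg : (4 * r n) @[n --> \oo] --> (0 : R).
  by rewrite -(mulr0 4); apply: cvgM => //; exact: cvg_cst.
have s_cvg j : cvg (s n j @[n --> \oo]).
  apply: cauchy_cvg; apply/cauchyP => e e0.
  have : \forall n \near \oo, 4 * r n < e by exact: cvgr_lt r4_cvg _ e0.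
  case=> N _ /(_ N (leqnn N)) /= hN; exists (s N j); exists N => // n /= Nn.
  rewrite -ball_normE /= distrC -(subnKC Nn).
  exact: le_lt_trans (s_dist4 j N (n - N)%N) hN.
pose l j : X := lim (s n j @[n --> \oo]).
have sl j n : `|l j - s n j| <= 4 * r n.
  have : `|s m j - s n j| @[m --> \oo] --> `|l j - s n j|.
    by apply: cvg_norm; apply: cvgB; [exact: s_cvg|exact: cvg_cst].
  move=> /cvgr_to_le; apply; exists n => // m /= nm.
  by rewrite -(subnKC nm); exact: s_dist4.
have lP : l \in @linf_pred R J X.
  have [M hM] := linf_bound (s 0); apply/linf_predP; exists (4 * r 0 + M) => j.
  by rewrite -[l j](subrK (s 0 j)) (le_trans (ler_normD _ _))// lerD.
pose L := Linf lP.
have Lq n : `|ultraclass L - q n| <= 4 * r n.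
  rewrite -sq -ultraclassN -ultraclassD norm_ultraclass.
  by apply: ulim_le => j; exact: (sl j n).
apply/cvg_ex; exists (ultraclass L); apply/cvgrPdist_lt => e e0.
have : \forall n \near \oo, 5 * r n < e.
  apply: (cvgr_lt _ _ _ e0); rewrite -(mulr0 5).
  by apply: cvgM => //; exact: cvg_cst.
case=> N _ /(_ N (leqnn N)) /= hN.
apply: filterS (qF N) => z; rewrite -ball_normE /= => zN.
rewrite -(subrKA (q N)) (le_lt_trans (ler_normD _ _))//.
by rewrite (le_lt_trans (lerD (Lq N) (ltW zN)))// (le_lt_trans _ hN)//; lra.
Qed.

HB.instance Definition _ :=
  Uniform_isComplete.Build ultrapower ultrapower_complete.

End ultrapower.

(* Main.v *)
Require Import Defs.
From mathcomp Require Import all_boot all_order all_algebra.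
From mathcomp Require Import all_classical all_reals.
From mathcomp Require Import topology normedtype interval_inference.
From mathcomp Require Import lra.

(** Along a [K]-regular ultrafilter, a family of functions on [J] indexed by
    (a set embedding in) [K] is, at each coordinate [j], only required to be
    handled at finitely many indices, and every index is among those for
    [U]-almost all [j]. Octahedrality of [X] solves each finite problem up to an
    error that tends to 0 along [U], so the solutions [y j] glue to a unit vector
    of the ultrapower solving the problem exactly. Regularity suffices, rather
    than goodness, because the finite problems are solvable at all coordinates. *)

Import Order.TTheory GRing.Theory Num.Theory.
Import numFieldNormedType.Exports.

Local Open Scope classical_set_scope.
Local Open Scope ring_scope.
Local Open Scope card_scope.

Lemma card_le_injective (T U : Type) :
  [set: T] #<= [set: U] -> exists h : T -> U, injective h.
Proof.
move=> /card_leP[f]; exists (fun a => set_val (f (SigSub (in_setT a)))).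
move=> a b /val_inj fab.
by have /(congr1 set_val) := inj (in_setT _) (in_setT _) fab.
Qed.

Lemma finite_set_card_lt_nat (T : choiceType) (A : set T) :
  finite_set A -> card_lt [set: A] [set: nat].
Proof.
move=> Afin; have ATfin : finite_set [set: A].
  by rewrite (eq_finite_set (card_setT A)).
split; first exact/finite_set_countable.
apply/negP => /eq_finite_set; rewrite propeqE => /iffLR /(_ ATfin).
exact: infinite_nat.
Qed.

Lemma octahedral_finite {R : realType} {X : completeNormedModType R}
    (hX : octahedral X) {A : set X} {eps : R} :
  finite_set A -> (forall x, A x -> `|x| = 1) -> 0 < eps ->
  exists2 y : X, `|y| = 1 & forall x, A x -> 2 - eps <= `|x + y|.
Proof.
move=> /finite_set_card_lt_nat Alt A1 eps0.
have [a|y y1 yA] := hX _ Alt (fun a : A => set_val a) _ _ eps0.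
  exact/A1/set_valP.
by exists y => // x Ax; exact: (yA (SigSub (mem_set Ax))).
Qed.

(** The empty family already yields a unit vector. *)
Lemma octahedral_unit {R : realType} {X : completeNormedModType R} :
  octahedral X -> exists e : X, `|e| = 1.
Proof.
move=> hX; have [|e e1 _] := octahedral_finite hX (finite_set0 X) _ ltr01 => //.
by exists e.
Qed.

(* Normalizing moves [x] by [ `| `|x| - 1| ]; at [x = 0] any unit vector [e]
   does. *)
Lemma near_unit {R : realType} {X : normedModType R} (e x : X) : `|e| = 1 ->
  exists2 u : X, `|u| = 1 & `|u - x| = `| `|x| - 1|.
Proof.
move=> e1; have [->|x0] := eqVneq x 0.
  by exists e => //; rewrite subr0 e1 normr0 sub0r normrN normr1.
exists (`|x|^-1 *: x).
  by rewrite normrZ ger0_norm ?invr_ge0// mulVf// normr_eq0.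
rewrite -[X in _ - X]scale1r -scalerBl normrZ -[X in _ * X](ger0_norm (normr_ge0 x)).
by rewrite -normrM mulrBl mulVf ?normr_eq0// mul1r distrC.
Qed.

(** Representatives of a unit class have norm close to 1 only along [U], so octahedrality is applied
    to nearby unit vectors; the triangle inequality charges the distance to the bound. *)
Lemma octahedral_finite_near {R : realType} {X : completeNormedModType R}
    (hX : octahedral X) {I : Type} {D : set I} (x : I -> X) {eps : R} :
  finite_set D -> 0 < eps ->
  exists2 y : X, `|y| = 1 &
    forall a, D a -> 2 - eps - `| `|x a| - 1| <= `|x a + y|.
Proof.
move=> Dfin eps0.
have [e e1] := octahedral_unit hX.
have /choice[u uP] a : exists u : X, `|u| = 1 /\ `|u - x a| = `| `|x a| - 1|.
  by have [u] := near_unit e (x a) e1; exists u.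
have [|y y1 yP] := octahedral_finite hX (finite_image u Dfin) _ eps0.
  by move=> _ [a _ <-]; exact: (uP a).1.
exists y => // a Da; have := yP (u a) (ex_intro2 _ _ a Da erefl).
have := ler_normD (u a - x a) (x a + y); rewrite addrA subrK (uP a).2; lra.
Qed.

(** A coordinate pairs the indices to handle with a precision. Its first component may be any set,
    so finiteness is imposed here. *)
Definition finite_supersets (K : Type) (p : set K * nat) : set (set K * nat) :=
  [set q | [/\ finite_set q.1, p.1 `<=` q.1 & (p.2 <= q.2)%N]].

(** Any ultrafilter containing these tails is [K]-regular: the sets of [j] with [j.1] finite and
    containing [k] belong to it, and each [j] lies in only finitely many of them. *)
Definition tail_filter (K : Type) : set_system (set K * nat) :=
  filter_from [set p | finite_set p.1] (@finite_supersets K).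

Lemma tail_filter_proper (K : Type) : ProperFilter (tail_filter K).
Proof.
apply: filter_from_proper => [|p pfin]; last by exists p; split.
apply: filter_from_filter; first by exists (set0, 0%N); exact: finite_set0.
move=> p q pfin qfin; exists (p.1 `|` q.1, maxn p.2 q.2).
  by rewrite /= finite_setU.
move=> r [rfin /=]; rewrite subUset geq_max => -[pr qr] /andP[pr2 qr2].
by split; split.
Qed.

Theorem theorem8p2 (R : realType) (X : completeNormedModType R)
    (hX : octahedral X) (K : Type) (hK : infinite_set [set: K]) :
  exists (J : Type) (U : set_system J) (UU : UltraFilter U),
    [/\ infinite_set [set: J], countably_incomplete U
      & card_rigid_octahedral K (ultrapower X UU)].
Proof.
have [U [UU tailU]] := ultraFilterLemma (tail_filter_proper K).
have U_in k : \forall j \near U, finite_set j.1 /\ j.1 k.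
  apply: tailU; exists ([set k], 0%N); first exact: finite_set1.
  by move=> j [jfin kj _]; split => //; exact: kj.
have U_ge n : \forall j \near U, (n <= j.2)%N.
  by apply: tailU; exists (set0, n); [exact: finite_set0|move=> j []].
exists (set K * nat)%type, U, UU; split.
- move=> /(finite_image snd); have -> : snd @` [set: set K * nat] = [set: nat].
    by apply/seteqP; split=> // n _; exists (set0, n).
  exact: infinite_nat.
- exists (fun n => [set j | (n <= j.2)%N]); split=> //.
  (* The point [j] is missing from the set of index [j.2.+1]. *)
  by apply/seteqP; split=> // j /(_ j.2.+1 I) /=; rewrite ltnn.
move=> I [/card_le_injective[h hinj] _] x x1.
have /choice[y yP] (j : set K * nat) : exists y : X, `|y| = 1 /\
    (finite_set j.1 -> forall a, j.1 (h a) ->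
      2 - j.2.+1%:R^-1 - `| `|repr (x a) j| - 1| <= `|repr (x a) j + y|).
  have eps0 : 0 < j.2.+1%:R^-1 :> R by rewrite invr_gt0.
  (* Coordinates with [j.1] infinite are [U]-negligible; any unit vector serves there. *)
  have [jfin|jinf] := pselect (finite_set j.1); last first.
    by have [y y1] := octahedral_unit hX; exists y.
  have [|y y1 yP] := octahedral_finite_near hX
    (D := h @^-1` j.1) (fun a => repr (x a) j) _ eps0.
    by apply: finite_preimage => // a b _ _; exact: hinj.
  by exists y; split => // _ a; exact: yP.
have y_linf : y \in @linf_pred R _ X.
  by apply/linf_predP; exists 1 => j; rewrite (yP j).1.
pose Y : linf _ X := Linf y_linf.
have Y1 : `|ultraclass UU Y| = 1.
  rewrite norm_ultraclass; apply: ulimP.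
  by apply: cvg_near_cst; apply: nearW => j; exact: (yP j).1.
exists (ultraclass UU Y) => // a; apply/eqP; rewrite eq_le; apply/andP; split.
  by rewrite (le_trans (ler_normD _ _))// x1 Y1.
(* The normalization defect of the representative vanishes along [U]. *)
have xcvg : `|repr (x a) j| @[j --> U] --> (1 : R).
  by rewrite -(x1 a); exact: ulim_cvg.
rewrite -[x a]ultraclassK -ultraclassD norm_ultraclass.
apply/ler_addgt0Pr => e e0; rewrite -lerBlDr.
apply: (cvgr_to_ge (ulim_cvg UU (f := repr (x a) + Y))).
(* Half of [e] absorbs the tolerance [j.2.+1%:R^-1], the other half the normalization defect. *)
have e20 : 0 < e / 2 by rewrite divr_gt0.
have [N eN] : exists N, N.+1%:R^-1 < e / 2.
  by have [N _ /(_ N (leqnn N))] := near_infty_natSinv_lt (PosNum e20); exists N.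
have /cvgrPdist_lt/(_ _ e20) xnear := xcvg.
near=> j.
have [jfin ja] : finite_set j.1 /\ j.1 (h a) by near: j; exact: U_in.
have Nj : (N <= j.2)%N by near: j; exact: U_ge.
have xj : `|1 - `|repr (x a) j| | < e / 2 by near: j.
have jN : j.2.+1%:R^-1 <= N.+1%:R^-1 :> R.
  by rewrite lef_pV2 ?posrE// ler_nat ltnS.
apply: le_trans ((yP j).2 jfin a ja).
rewrite -[leRHS]addrA -opprD lerD2l lerN2 [e]splitr lerD// ltW//.
  exact: le_lt_trans eN.
by rewrite distrC.
Unshelve. all: by end_near.
Qed.
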